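(* Consider the problem (MF) $$\min_{\hat{\mathbf x}_i,\, i\in\mathcal V}\ \sum_{i\in\mathcal V}\Phi_i(\hat{\mathbf x}_i)\quad\text{s.t.}\quad \mathbf A_i\hat{\mathbf x}_i\le \mathbf a_i,\qquad \mathbf B_{ii}\hat{\mathbf x}_i+\sum_{j\in\mathcal N_i}\mathbf B_{ji}\hat{\mathbf x}_j\le \mathbf b_i,\qquad \forall i\in\mathcal V,$$ of the microgrid network, with all data and standing assumptions as specified in the context, and let $\mathbf x^{opt}=\mathrm{col}\{\mathbf x_i^{opt}:i\in\mathcal V\}$ be its (unique) optimal solution. Let $\rho>0$, and from arbitrary initial values $\mathbf u_i(0),\boldsymbol\lambda_i(0),\boldsymbol\lambda_{ij}^{(1)}(0),\boldsymbol\lambda_{ij}^{(2)}(0)$ ($i\in\mathcal V$, $j\in\mathcal N_i$) let sequences be generated for $s=0,1,2,\dots$ by the following updates, for all $i\in\mathcal V$ and $j\in\mathcal N_i$: $$\mathbf v_i(s+1)=\bigl[\mathbf M_i\mathbf u_i(s)-\mathbf m_i-\tfrac1\rho\boldsymbol\lambda_i(s)\bigr]_+,$$ $$\mathbf v_{ij}^{(1)}(s+1)=\tfrac12\bigl(\mathbf S_{ij}\mathbf u_i(s)-\tfrac1\rho\boldsymbol\lambda_{ij}^{(1)}(s)+\mathbf R_{ji}\mathbf u_j(s)-\tfrac1\rho\boldsymbol\lambda_{ji}^{(2)}(s)\bigr),$$ $$\mathbf v_{ij}^{(2)}(s+1)=\tfrac12\bigl(\mathbf S_{ji}\mathbf u_j(s)-\tfrac1\rho\boldsymbol\lambda_{ji}^{(1)}(s)+\mathbf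 R_{ij}\mathbf u_i(s)-\tfrac1\rho\boldsymbol\lambda_{ij}^{(2)}(s)\bigr),$$ $$\begin{aligned}\mathbf u_i(s+1)=\arg\min_{\hat{\mathbf u}_i}\Bigl\{&\hat\Phi_i(\hat{\mathbf u}_i)+\tfrac\rho2\bigl\|\mathbf M_i\hat{\mathbf u}_i-\mathbf v_i(s+1)-\mathbf m_i-\tfrac1\rho\boldsymbol\lambda_i(s)\bigr\|^2\\&+\tfrac\rho2\sum_{j\in\mathcal N_i}\Bigl(\bigl\|\mathbf S_{ij}\hat{\mathbf u}_i-\mathbf v_{ij}^{(1)}(s+1)-\tfrac1\rho\boldsymbol\lambda_{ij}^{(1)}(s)\bigr\|^2+\bigl\|\mathbf R_{ij}\hat{\mathbf u}_i-\mathbf v_{ij}^{(2)}(s+1)-\tfrac1\rho\boldsymbol\lambda_{ij}^{(2)}(s)\bigr\|^2\Bigr)\Bigr\},\end{aligned}$$ $$\boldsymbol\lambda_i(s+1)=\boldsymbol\lambda_i(s)-\rho\bigl(\mathbf M_i\mathbf u_i(s+1)-\mathbf m_i-\mathbf v_i(s+1)\bigr),$$ $$\boldsymbol\lambda_{ij}^{(1)}(s+1)=\boldsymbol\lambda_{ij}^{(1)}(s)-\rho\bigl(\mathbf S_{ij}\mathbf u_i(s+1)-\mathbf v_{ij}^{(1)}(s+1)\bigr),$$ $$\boldsymbol\lambda_{ij}^{(2)}(s+1)=\boldsymbol\lambda_{ij}^{(2)}(s)-\rho\bigl(\mathbf R_{ij}\mathbf u_i(s+1)-\mathbf v_{ij}^{(2)}(s+1)\bigr).$$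 Then, with $\mathbf P_i=[\,\mathbf I_{n_i}\ \ \mathbf 0_{n_i\times K|\mathcal N_i|}\,]$, $$\lim_{s\to\infty}\mathbf P_i\mathbf u_i(s)=\mathbf x_i^{opt},\qquad\forall i\in\mathcal V.$$
   Context: Notation. $\mathrm{col}\{\cdot\}$ stacks vectors into one column vector; vector inequalities are componentwise; $[\mathbf x]_+$ is the componentwise maximum of $\mathbf x$ and $0$; $\|\cdot\|$ is the Euclidean norm; $\otimes$ is the Kronecker product; $\mathbf 1_n$ is the all-ones vector in $\mathbb R^n$. Network. $\mathcal G=(\mathcal V,\mathcal E)$ is a connected undirected graph with $\mathcal V=\{1,\dots,N\}$ ($(i,j)\in\mathcal E$ iff $(j,i)\in\mathcal E$); $\mathcal N_i=\{j:(i,j)\in\mathcal E\}$; $\mathcal V^G,\mathcal V^E\subset\mathcal V$ are the nodes with generators and with energy storage, respectively. $t_0$ is the current time and $K>1$ the integer horizon length; $t$ ranges over $t_0,\dots,t_0+K-1$. Decision variables (real): $P_i(t)$ for $i\in\mathcal V^G$; $E_i^c(t),E_i^d(t)$ for $i\in\mathcal V^E$; $F_{ij}(t)$ for $(i,j)\in\mathcal E$. By convention $P_i(t)=0$ for $i\notin\mathcal V^G$ and $E^c_i(t)=E^d_i(t)=0$ for $i\notin\mathcal V^E$. Constraints, for all $t$ in the horizon: (1) $0\le P_i(t)\le\tilde P_{i,t}$ and $\underline R_i\le P_i(t)-P_i(t-1)\le\overline R_i$ for $i\in\mathcal V^G$, with $P_i(t_0-1)$ given; (2) for $i\in\mathcal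 V^E$: $0\le E_i^c(t)\le\overline{E_i^c}$, $0\le E_i^d(t)\le\overline{E_i^d}$, and $0\le SoC_i(t+1)\le\overline{SoC_i}$, where $SoC_i(t+1)=(1-eff_i)SoC_i(t)+c_iE_i^c(t)-d_iE_i^d(t)$, with $SoC_i(t_0)$ given, $eff_i\in[0,1)$, $c_i>0$, $d_i>0$; (3) $0\le F_{ij}(t)\le\overline{F_{ij}}$ for $(i,j)\in\mathcal E$; (4) $P_i(t)-E_i^c(t)+E_i^d(t)+\sum_{j\in\mathcal N_i}[F_{ji}(t)-F_{ij}(t)]\ge\tilde D_{i,t}$ for $i\in\mathcal V$. All bounds are given real numbers; here $\tilde D_{i,t}=\mathrm{Expt}[D_i(t)]+\sqrt{(1-\epsilon)/\epsilon}\,\mathrm{Var}[D_i(t)]$ and $\tilde P_{i,t}=\mathrm{Expt}[\overline{P_i}(t)]-\sqrt{(1-\epsilon)/\epsilon}\,\mathrm{Var}[\overline{P_i}(t)]$ for given expectations and variances of the demand $D_i(t)$ and generation capacity $\overline{P_i}(t)$ and a given $\epsilon\in(0,1)$. Local vectors and costs. $\hat{\mathbf x}_i\in\mathbb R^{n_i}$ stacks all variables of agent $i$ over the horizon: $P_i(t)$ (if $i\in\mathcal V^G$), $E_i^c(t),E_i^d(t)$ (if $i\in\mathcal V^E$), $F_{ij}(t)$ for $j\in\mathcal N_i$. $\Phi_i(\hat{\mathbf x}_i)$ is the sum over $t$ of $\Phi_i^g(P_i(t))$ (if $i\in\mathcal V^G$), $\Phi_i^c(E_i^c(t))+\Phi_i^d(E_i^d(t))$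 (if $i\in\mathcal V^E$) and $\sum_{j\in\mathcal N_i}\Phi_{ij}^f(F_{ij}(t))$. Matrices of (MF). $\mathbf A_i\hat{\mathbf x}_i\le\mathbf a_i$ ($\mathbf A_i\in\mathbb R^{m_i\times n_i}$) is the system of all local constraints (1), (2), (3) of agent $i$ written as linear inequalities in $\hat{\mathbf x}_i$ (with $SoC_i$ eliminated through its recursion). $\mathbf B_{ii},\mathbf B_{ij}\in\mathbb R^{K\times n_i}$ are defined by $\mathbf B_{ii}\hat{\mathbf x}_i=\mathrm{col}\{-P_i(t)+E_i^c(t)-E_i^d(t)+\sum_{j\in\mathcal N_i}F_{ij}(t):t\}$ and $\mathbf B_{ij}\hat{\mathbf x}_i=\mathrm{col}\{-F_{ij}(t):t\}$ for $j\in\mathcal N_i$, and $\mathbf b_i=\mathrm{col}\{-\tilde D_{i,t}:t\}$, so the second constraint of (MF) is (4). Objects in the updates. Agent $i$ keeps copies $F_{ji}^{copy}(t)$ of $F_{ji}(t)$ for $j\in\mathcal N_i$; $\hat{\mathbf x}_{ij}=\mathrm{col}\{F_{ji}^{copy}(t):t\}\in\mathbb R^K$ and $\hat{\mathbf u}_i=\mathrm{col}\{\hat{\mathbf x}_i,\mathrm{col}\{\hat{\mathbf x}_{ij}:j\in\mathcal N_i\}\}\in\mathbb R^{n_i+K|\mathcal N_i|}$. $\hat\Phi_i(\hat{\mathbf u}_i)=\Phi_i(\hat{\mathbf x}_i)$. The matrices $\mathbf S_{ij},\mathbf R_{ij}$ are defined by $\mathbf S_{ij}\hat{\mathbf u}_i=\hat{\mathbf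 x}_{ij}$ and $\mathbf R_{ij}\hat{\mathbf u}_i=\mathrm{col}\{F_{ij}(t):t\}$ for $j\in\mathcal N_i$, and $$\mathbf M_i=\begin{bmatrix}-\mathbf A_i&\mathbf 0\\-\mathbf B_{ii}&\mathbf 1_{|\mathcal N_i|}^T\otimes\mathbf I_K\end{bmatrix},\qquad\mathbf m_i=\begin{bmatrix}-\mathbf a_i\\-\mathbf b_i\end{bmatrix}.$$ The vectors $\mathbf v_i(s),\boldsymbol\lambda_i(s)$ lie in $\mathbb R^{m_i+K}$, and $\mathbf v_{ij}^{(1)}(s),\mathbf v_{ij}^{(2)}(s),\boldsymbol\lambda_{ij}^{(1)}(s),\boldsymbol\lambda_{ij}^{(2)}(s)$ lie in $\mathbb R^K$. Standing assumptions. (i) All the scalar functions $\Phi_i^g,\Phi_i^c,\Phi_i^d,\Phi_{ij}^f:\mathbb R\to\mathbb R$ are strongly convex and smooth (continuously differentiable with Lipschitz gradient) and increasing on $[0,\infty)$. (ii) There is a point satisfying all inequality constraints (1)–(4) strictly. *)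

(* Defs.v *)
From HB Require Import structures.
From mathcomp Require Import all_boot all_order all_algebra.
From mathcomp Require Import all_classical all_reals all_analysis.
From mathcomp.real_closed Require Export mxtens.
From mathcomp Require Import ring lra.

Export Order.TTheory GRing.Theory Num.Theory.
Export numFieldNormedType.Exports.

Local Open Scope classical_set_scope.
Local Open Scope ring_scope.

Section RealVectors.
Context {R : realType}.

Definition cv_le {n} (x y : 'cV[R]_n) : Prop := forall r, x r 0 <= y r 0.

Definition pospart {n} (x : 'cV[R]_n) : 'cV[R]_n :=
  map_mx (fun z => Num.max z 0) x.

(* The norm that MathComp-Analysis puts on matrices is the max norm. *)
Definition enorm {n} (x : 'cV[R]_n) : R := Num.sqrt (\sum_r x r 0 ^+ 2).

Definition is_argmin {T : Type} (f : T -> R) (x : T) : Prop :=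
  forall y, f x <= f y.

(* The matrix of the linear part of an affine map f; when f is linear it is the
   unique matrix A with A x = f x. *)
Definition mx_of {m n} (f : 'cV[R]_n -> 'cV[R]_m) : 'M[R]_(m, n) :=
  \matrix_(r, c) (f (delta_mx c 0) - f 0) r 0.

Definition strongly_convex (f : R -> R) : Prop :=
  exists2 m : R, 0 < m & forall x y s : R, 0 <= s <= 1 ->
    f (s * x + (1 - s) * y)
      <= s * f x + (1 - s) * f y - m / 2 * s * (1 - s) * (x - y) ^+ 2.

Definition smooth (f : R -> R) : Prop :=
  [/\ forall x, derivable f x 1, continuous (derive1 f) & lipschitz (derive1 f)].

Definition increasing_on_nonneg (f : R -> R) : Prop :=
  forall x y : R, 0 <= x -> x < y -> f x < f y.

Definition good_cost (f : R -> R) : Prop :=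
  [/\ strongly_convex f, smooth f & increasing_on_nonneg f].

End RealVectors.

(* The quantities of one agent that are subject to bounds.  Pq, Ecq, Edq and
   Fq j are decision variables; Rampq stands for P(t) - P(t-1) and SoCq for
   SoC(t+1), which are functions of them. *)
Inductive quantity (V : Type) : Type :=
  Pq | Rampq | Ecq | Edq | SoCq | Fq of V.

Arguments Pq {V}.
Arguments Rampq {V}.
Arguments Ecq {V}.
Arguments Edq {V}.
Arguments SoCq {V}.
Arguments Fq {V}.

Section QuantityFinite.
Variable V : finType.

Definition quantity_code (q : quantity V) :
    option (option (option (option (option V)))) :=
  match q with
  | Pq => None
  | Rampq => Some None
  | Ecq => Some (Some None)
  | Edq => Some (Some (Some None))
  | SoCq => Some (Some (Some (Some None)))
  | Fq j => Some (Some (Some (Some (Some j))))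
  end.

Definition quantity_decode (o : option (option (option (option (option V))))) :
    quantity V :=
  match o with
  | None => Pq
  | Some None => Rampq
  | Some (Some None) => Ecq
  | Some (Some (Some None)) => Edq
  | Some (Some (Some (Some None))) => SoCq
  | Some (Some (Some (Some (Some j)))) => Fq j
  end.

Lemma quantity_codeK : cancel quantity_code quantity_decode.
Proof. by case. Qed.

HB.instance Definition _ := Finite.copy (quantity V) (can_type quantity_codeK).

End QuantityFinite.

(* Data that are only meaningful on part of the network (generators, storage,
   lines) are total functions, whose values elsewhere are never used.
   Time-dependent data are indexed by absolute time. *)
Record microgrid (R : realType) := Microgrid {
  nbus : nat;
  adj : rel 'I_nbus;
  VG : {set 'I_nbus};
  VE : {set 'I_nbus};
  horizon : nat;
  t0 : int;
  eps : R;
  exptD : 'I_nbus -> int -> R;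
  varD : 'I_nbus -> int -> R;
  exptP : 'I_nbus -> int -> R;
  varP : 'I_nbus -> int -> R;
  Pinit : 'I_nbus -> R;                         (* P_i(t0 - 1) *)
  Rlow : 'I_nbus -> R;
  Rupp : 'I_nbus -> R;
  Ecmax : 'I_nbus -> R;
  Edmax : 'I_nbus -> R;
  SoCmax : 'I_nbus -> R;
  SoCinit : 'I_nbus -> R;                       (* SoC_i(t0) *)
  eff : 'I_nbus -> R;
  cchg : 'I_nbus -> R;                          (* c_i *)
  ddis : 'I_nbus -> R;                          (* d_i *)
  Fmax : 'I_nbus -> 'I_nbus -> R;
  Phig : 'I_nbus -> R -> R;
  Phic : 'I_nbus -> R -> R;
  Phid : 'I_nbus -> R -> R;
  Phif : 'I_nbus -> 'I_nbus -> R -> R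
}.

Arguments nbus {R}.
Arguments adj {R}.
Arguments VG {R}.
Arguments VE {R}.
Arguments horizon {R}.
Arguments t0 {R}.
Arguments eps {R}.
Arguments exptD {R}.
Arguments varD {R}.
Arguments exptP {R}.
Arguments varP {R}.
Arguments Pinit {R}.
Arguments Rlow {R}.
Arguments Rupp {R}.
Arguments Ecmax {R}.
Arguments Edmax {R}.
Arguments SoCmax {R}.
Arguments SoCinit {R}.
Arguments eff {R}.
Arguments cchg {R}.
Arguments ddis {R}.
Arguments Fmax {R}.
Arguments Phig {R}.
Arguments Phic {R}.
Arguments Phid {R}.
Arguments Phif {R}.

Section Microgrid.
Context {R : realType} (G : microgrid R).

Local Notation bus := 'I_(nbus G).
Local Notation K := (horizon G).

Definition connected_graph : Prop :=
  [/\ (0 < nbus G)%N, irreflexive (adj G), symmetric (adj G)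
    & forall i j : bus, connect (adj G) i j].

(* A time of type nat is the offset from t0, in 0, ..., K - 1. *)
Definition Dtilde (i : bus) (t : nat) : R :=
  let T := t0 G + t%:Z in
  exptD G i T + Num.sqrt ((1 - eps G) / eps G) * varD G i T.

Definition Ptilde (i : bus) (t : nat) : R :=
  let T := t0 G + t%:Z in
  exptP G i T - Num.sqrt ((1 - eps G) / eps G) * varP G i T.

Definition well_posed_data : Prop :=
  [/\ (1 < K)%N,
      0 < eps G < 1,
      forall (i : bus) (t : int), 0 <= varD G i t,
      forall (i : bus) (t : int), i \in VG G -> 0 <= varP G i t
    & forall i : bus, i \in VE G ->
        [/\ 0 <= eff G i < 1, 0 < cchg G i & 0 < ddis G i]].

Definition good_costs : Prop :=
  [/\ forall i : bus, i \in VG G -> good_cost (Phig G i),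
      forall i : bus, i \in VE G -> good_cost (Phic G i),
      forall i : bus, i \in VE G -> good_cost (Phid G i)
    & forall i j : bus, adj G i j -> good_cost (Phif G i j)].

Definition is_variable (i : bus) (q : quantity bus) : bool :=
  match q with
  | Pq => i \in VG G
  | Ecq | Edq => i \in VE G
  | Fq j => adj G i j
  | Rampq | SoCq => false
  end.

Definition variable (i : bus) :=
  {a : quantity bus * 'I_K | is_variable i a.1}.

Definition nvar (i : bus) : nat := #|{: variable i}|.

(* Value in x of the decision variable q of agent i at time t; it is 0 when i
   has no such variable. *)
Definition varval (i : bus) (x : 'cV[R]_(nvar i)) (q : quantity bus) (t : nat) : R :=
  if insub t is Some t' then
    if insub (q, t') is Some a then x (enum_rank (a : variable i)) 0 else 0
  else 0.

Definition Pgen (i : bus) (x : 'cV[R]_(nvar i)) (t : nat) : R := varval i x Pq t.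
Definition Ec (i : bus) (x : 'cV[R]_(nvar i)) (t : nat) : R := varval i x Ecq t.
Definition Ed (i : bus) (x : 'cV[R]_(nvar i)) (t : nat) : R := varval i x Edq t.
Definition Flow (i : bus) (x : 'cV[R]_(nvar i)) (j : bus) (t : nat) : R :=
  varval i x (Fq j) t.

Definition Pprev (i : bus) (x : 'cV[R]_(nvar i)) (t : nat) : R :=
  if t is t'.+1 then Pgen i x t' else Pinit G i.

Fixpoint SoC (i : bus) (x : 'cV[R]_(nvar i)) (t : nat) : R :=
  if t is t'.+1 then
    (1 - eff G i) * SoC i x t' + cchg G i * Ec i x t' - ddis G i * Ed i x t'
  else SoCinit G i.

(* The local constraints of agent i and its power balance, with r in place of
   <=, so that r := <%R gives the strict versions. *)
Definition local_constraints (r : rel R) (i : bus) (x : 'cV[R]_(nvar i)) : Prop :=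
  [/\ i \in VG G -> forall t, (t < K)%N ->
        (r 0 (Pgen i x t) && r (Pgen i x t) (Ptilde i t)) /\
        (r (Rlow G i) (Pgen i x t - Pprev i x t) &&
         r (Pgen i x t - Pprev i x t) (Rupp G i)),
      i \in VE G -> forall t, (t < K)%N ->
        [/\ r 0 (Ec i x t) && r (Ec i x t) (Ecmax G i),
            r 0 (Ed i x t) && r (Ed i x t) (Edmax G i)
          & r 0 (SoC i x t.+1) && r (SoC i x t.+1) (SoCmax G i)]
    & forall j, adj G i j -> forall t, (t < K)%N ->
        r 0 (Flow i x j t) && r (Flow i x j t) (Fmax G i j)].

Definition power_balance (r : rel R) (x : forall i, 'cV[R]_(nvar i)) (i : bus) :
    Prop :=
  forall t, (t < K)%N ->
    r (Dtilde i t)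
      (Pgen i (x i) t - Ec i (x i) t + Ed i (x i) t
        + \sum_(j | adj G i j) (Flow j (x j) i t - Flow i (x i) j t)).

Definition strictly_feasible : Prop :=
  exists x : forall i, 'cV[R]_(nvar i),
    forall i, local_constraints <%R i (x i) /\ power_balance <%R x i.

Definition Phi (i : bus) (x : 'cV[R]_(nvar i)) : R :=
  \sum_(0 <= t < K)
    ((if i \in VG G then Phig G i (Pgen i x t) else 0)
     + (if i \in VE G then Phic G i (Ec i x t) + Phid G i (Ed i x t) else 0)
     + \sum_(j | adj G i j) Phif G i j (Flow i x j t)).

(* Every local constraint has the form low <= quantity <= upp; each of the two
   inequalities, at each time, is a row of A_i. *)
Definition is_constrained (i : bus) (q : quantity bus) : bool :=
  match q with
  | Pq | Rampq => i \in VG G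
  | Ecq | Edq | SoCq => i \in VE G
  | Fq j => adj G i j
  end.

Definition value (i : bus) (x : 'cV[R]_(nvar i)) (q : quantity bus) (t : nat) : R :=
  match q with
  | Pq => Pgen i x t
  | Rampq => Pgen i x t - Pprev i x t
  | Ecq => Ec i x t
  | Edq => Ed i x t
  | SoCq => SoC i x t.+1
  | Fq j => Flow i x j t
  end.

Definition low (i : bus) (q : quantity bus) : R :=
  if q is Rampq then Rlow G i else 0.

Definition upp (i : bus) (q : quantity bus) (t : nat) : R :=
  match q with
  | Pq => Ptilde i t
  | Rampq => Rupp G i
  | Ecq => Ecmax G i
  | Edq => Edmax G i
  | SoCq => SoCmax G i
  | Fq j => Fmax G i j
  end.

Definition constraint (i : bus) :=
  {c : quantity bus * bool * 'I_K | is_constrained i c.1.1}.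

Definition ncon (i : bus) : nat := #|{: constraint i}|.

(* The boolean selects the upper bound; the constraint reads residual <= 0. *)
Definition residual (i : bus) (x : 'cV[R]_(nvar i)) : 'cV[R]_(ncon i) :=
  \col_r let: (q, upper, t) := \val (enum_val r : constraint i) in
         if upper then value i x q t - upp i q t else low i q - value i x q t.

Definition Amx (i : bus) : 'M[R]_(ncon i, nvar i) := mx_of (residual i).
Definition avec (i : bus) : 'cV[R]_(ncon i) := - residual i 0.

(* B_ii and B_ij. *)
Definition Bmx (i j : bus) : 'M[R]_(K, nvar i) :=
  if j == i then
    mx_of (fun x : 'cV[R]_(nvar i) => \col_(t < K)
      (- Pgen i x t + Ec i x t - Ed i x t + \sum_(k | adj G i k) Flow i x k t))
  else
    mx_of (fun x : 'cV[R]_(nvar i) => \col_(t < K) - Flow i x j t).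

Definition bvec (i : bus) : 'cV[R]_K := \col_(t < K) - Dtilde i t.

Definition MF_feasible (x : forall i, 'cV[R]_(nvar i)) : Prop :=
  forall i,
    cv_le (Amx i *m x i) (avec i) /\
    cv_le (Bmx i i *m x i + \sum_(j | adj G i j) Bmx j i *m x j) (bvec i).

Definition MF_optimal (x : forall i, 'cV[R]_(nvar i)) : Prop :=
  MF_feasible x /\
  forall y, MF_feasible y -> \sum_i Phi i (x i) <= \sum_i Phi i (y i).

Definition neighbor (i : bus) := {j : bus | adj G i j}.
Definition deg (i : bus) : nat := #|{: neighbor i}|.

(* u_i stacks x_i (the upper block) and the x_ij for j a neighbor of i. *)
Definition ndim (i : bus) : nat := (nvar i + deg i * K)%N.

(* x_ij as a part of u_i, and 0 if j is not a neighbor of i. *)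
Definition copy_of (i j : bus) (u : 'cV[R]_(ndim i)) : 'cV[R]_K :=
  if insub j is Some j' then
    \col_t dsubmx u (mxtens_index (enum_rank (j' : neighbor i), t)) 0
  else 0.

Definition Phihat (i : bus) (u : 'cV[R]_(ndim i)) : R := Phi i (usubmx u).

Definition Smx (i j : bus) : 'M[R]_(K, ndim i) := mx_of (copy_of i j).

Definition Rmx (i j : bus) : 'M[R]_(K, ndim i) :=
  mx_of (fun u : 'cV[R]_(ndim i) => \col_(t < K) Flow i (usubmx u) j t).

Definition Mmx (i : bus) : 'M[R]_(ncon i + K, ndim i) :=
  block_mx (- Amx i) 0
           (- Bmx i i)
           (castmx (mul1n K, erefl)
              (tensmx (const_mx 1 : 'rV[R]_(deg i)) (1%:M : 'M[R]_K))).

Definition mvec (i : bus) : 'cV[R]_(ncon i + K) := col_mx (- avec i) (- bvec i).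

Definition Pmx (i : bus) : 'M[R]_(nvar i, ndim i) := row_mx 1%:M 0.

End Microgrid.

Section Characterizations.
Context {R : realType}.

Definition is_affine {m n} (f : 'cV[R]_n -> 'cV[R]_m) :=
  forall (a : R) x y, f (a *: x + y) - f 0 = a *: (f x - f 0) + (f y - f 0).

Lemma mx_ofE m n (f : 'cV[R]_n -> 'cV[R]_m) :
  is_affine f -> forall x, mx_of f *m x = f x - f 0.
Proof.
move=> Hf x.
pose g y := f y - f 0.
have gl a y z : g (a *: y + z) = a *: g y + g z by exact: Hf.
have g0 : g 0 = 0 by rewrite /g subrr.
have gs : forall (s : seq 'I_n) (h : 'I_n -> R) (e : 'I_n -> 'cV[R]_n),
   g (\sum_(i <- s) h i *: e i) = \sum_(i <- s) h i *: g (e i).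
  move=> s h e; elim: s => [|b s IH]; first by rewrite !big_nil.
  by rewrite !big_cons gl IH.
have xE : x = \sum_c x c 0 *: delta_mx c 0.
  rewrite {1}(matrix_sum_delta x); apply: eq_bigr => c _.
  by rewrite big_ord1.
rewrite -/(g x) {2}xE gs.
apply/matrixP => r c; rewrite !mxE summxE; apply: eq_bigr => k _.
by rewrite !mxE (ord1 c) mulrC.
Qed.

Variable G : microgrid R.
Local Notation bus := 'I_(nbus G).
Local Notation K := (horizon G).

Lemma varval_linear (i : bus) q t (a : R) (x y : 'cV[R]_(nvar G i)) :
  varval G i (a *: x + y) q t = a * varval G i x q t + varval G i y q t.
Proof.
rewrite /varval; case: insub => [t'|]; last by ring.
by case: insub => [b|]; rewrite ?mxE //; ring.
Qed.
Lemma varval0 (i : bus) q t : varval G i 0 q t = 0.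
Proof. by rewrite /varval; case: insub => // t'; case: insub => // b; rewrite mxE. Qed.

Lemma SoC_affine (i : bus) t (a : R) (x y : 'cV[R]_(nvar G i)) :
  SoC G i (a *: x + y) t - SoC G i 0 t = a * (SoC G i x t - SoC G i 0 t) + (SoC G i y t - SoC G i 0 t).
Proof.
elim: t => [|t IH] /=; first by ring.
rewrite /Ec /Ed !varval_linear !varval0.
set A := SoC _ _ _ _ in IH *; set B := SoC _ _ _ _ in IH *.
have -> : A = a * (SoC G i x t - B) + (SoC G i y t - B) + B by rewrite -IH; ring.
ring.
Qed.

Lemma value_affine (i : bus) q t (a : R) (x y : 'cV[R]_(nvar G i)) :
  value G i (a *: x + y) q t - value G i 0 q t
  = a * (value G i x q t - value G i 0 q t) + (value G i y q t - value G i 0 q t).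
Proof.
case: q => [|||||j]; rewrite /value; last first.
all: rewrite ?/Flow ?/Pgen ?/Ec ?/Ed ?varval_linear ?varval0; try ring.
- exact: SoC_affine.
- case: t => [|t] /=; rewrite /Pgen ?varval_linear ?varval0; ring.
Qed.

Lemma Amx_mul (i : bus) x : Amx G i *m x - avec G i = residual G i x.
Proof.
rewrite /Amx /avec mx_ofE ?opprK ?subrK //.
move=> a {}x y; apply/matrixP => r c; rewrite !mxE.
case: (\val _) => [[q b] t]; case: b; have := value_affine i q t a x y; lra.
Qed.

Lemma Amx_local_constraints (i : bus) x :
  cv_le (Amx G i *m x) (avec G i) <-> local_constraints G <=%R i x.
Proof.
have -> : cv_le (Amx G i *m x) (avec G i) <-> (forall r, residual G i x r 0 <= 0).
  by rewrite -Amx_mul; split => H r; have := H r; rewrite !mxE subr_le0.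
have E : (forall r, residual G i x r 0 <= 0) <->
  (forall q (t : nat), (t < K)%N -> is_constrained G i q -> low G i q <= value G i x q t <= upp G i q t).
  split.
    move=> H q t tK Hq.
    have Hb (b : bool) : is_constrained G i (q, b, Ordinal tK).1.1 by [].
    have := H (enum_rank (exist (fun c => is_constrained G i c.1.1) _ (Hb true) : constraint G i)).
    have := H (enum_rank (exist (fun c => is_constrained G i c.1.1) _ (Hb false) : constraint G i)).
    by rewrite !mxE !enum_rankK /= !subr_le0 => -> ->.
  move=> H r; rewrite mxE; case: (enum_val r) => [[[q b] t] /= Hc].
  have /andP[h1 h2] := H q t (ltn_ord t) Hc.
  by case: b Hc; rewrite subr_le0.
rewrite E /local_constraints; split.
  move=> H; split.
  - by move=> Hi t tK; rewrite (H Pq t tK Hi) (H Rampq t tK Hi).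
  - by move=> Hi t tK; rewrite (H Ecq t tK Hi) (H Edq t tK Hi) (H SoCq t tK Hi).
  - by move=> j Hi t tK; rewrite (H (Fq j) t tK Hi).
move=> [H1 H2 H3] q t tK; case: q => [|||||j] /= Hi.
- by case: (H1 Hi t tK).
- by case: (H1 Hi t tK).
- by case: (H2 Hi t tK).
- by case: (H2 Hi t tK).
- by case: (H2 Hi t tK).
- exact: (H3 j Hi t tK).
Qed.

Lemma Bmx_diag_mul (i : bus) x : Bmx G i i *m x = \col_(t < K)
      (- Pgen G i x t + Ec G i x t - Ed G i x t + \sum_(k | adj G i k) Flow G i x k t).
Proof.
have S0 t : \sum_(k | adj G i k) Flow G i 0 k t = 0.
  by rewrite big1 // => k _; rewrite /Flow varval0.
rewrite /Bmx eqxx mx_ofE.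
  apply/matrixP => r c; rewrite !mxE S0 /Pgen /Ec /Ed !varval0; ring.
move=> a {}x y; apply/matrixP => r c; rewrite !mxE S0 /Pgen /Ec /Ed !varval_linear !varval0.
have -> : \sum_(k | adj G i k) Flow G i (a *: x + y) k r = a * \sum_(k | adj G i k) Flow G i x k r + \sum_(k | adj G i k) Flow G i y k r.
  by rewrite mulr_sumr -big_split; apply: eq_bigr => k _; rewrite /Flow varval_linear.
ring.
Qed.

Lemma Bmx_off_mul (i j : bus) x : j != i -> Bmx G i j *m x = \col_(t < K) - Flow G i x j t.
Proof.
move=> /negPf ji; rewrite /Bmx ji mx_ofE.
  apply/matrixP => r c; rewrite !mxE /Flow !varval0; ring.
move=> a {}x y; apply/matrixP => r c; rewrite !mxE /Flow !varval_linear !varval0; ring.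
Qed.

Lemma Bmx_power_balance (x : forall i, 'cV[R]_(nvar G i)) i : irreflexive (adj G) -> 
  cv_le (Bmx G i i *m x i + \sum_(j | adj G i j) Bmx G j i *m x j) (bvec G i)
  <-> power_balance G <=%R x i.
Proof.
move=> irr.
have E t : (Bmx G i i *m x i + \sum_(j | adj G i j) Bmx G j i *m x j) t 0
  = - (Pgen G i (x i) t - Ec G i (x i) t + Ed G i (x i) t
        + \sum_(j | adj G i j) (Flow G j (x j) i t - Flow G i (x i) j t)).
  rewrite Bmx_diag_mul mxE summxE mxE sumrB.
  have -> : \sum_(j | adj G i j) (Bmx G j i *m x j) t 0 = - \sum_(j | adj G i j) Flow G j (x j) i t.
    rewrite -sumrN; apply: eq_bigr => j ij; rewrite Bmx_off_mul ?mxE //.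
    by apply/eqP => e; move: ij; rewrite e irr.
  ring.
split=> H t.
  by move=> tK; have := H (Ordinal tK); rewrite E mxE lerN2.
by rewrite E mxE lerN2; exact: H.
Qed.

Lemma Smx_mul i j u : Smx G i j *m u = copy_of G i j u.
Proof.
have z : copy_of G i j 0 = 0.
  rewrite /copy_of; case: insub => // k; apply/matrixP => r c.
  by rewrite linear0 !mxE.
rewrite mx_ofE ?z ?subr0 // => a x y; rewrite [copy_of G i j 0]z !subr0 /copy_of.
case: insub => [k|]; last by rewrite scaler0 addr0.
by apply/matrixP => r c; rewrite linearP !mxE.
Qed.

Lemma Rmx_mul i j u : Rmx G i j *m u = \col_(t < K) Flow G i (usubmx u) j t.
Proof.
have z : (\col_(t < K) Flow G i (usubmx (0 : 'cV_(ndim G i))) j t) = 0.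
  by apply/matrixP => r c; rewrite linear0 !mxE /Flow varval0.
rewrite mx_ofE ?z ?subr0 // => a x y; rewrite [X in _ - X = _]z [X in _ *: (_ - X)]z [X in _ + (_ - X)]z !subr0.
by apply/matrixP => r c; rewrite linearP !mxE /Flow varval_linear.
Qed.

Lemma Mmx_mul (i : bus) (x : 'cV[R]_(nvar G i)) y :
  let u := col_mx x y : 'cV[R]_(ndim G i) in
  Mmx G i *m u - mvec G i =
  col_mx (avec G i - Amx G i *m x)
   (bvec G i - Bmx G i i *m x + \sum_(j | adj G i j) copy_of G i j u).
Proof.
move=> u; rewrite /Mmx /mvec mul_block_col opp_col_mx add_col_mx !opprK mul0mx addr0 !mulNmx.
congr col_mx; first by rewrite addrC.
rewrite -addrA [_ + bvec _ _]addrC addrA [- _ + _]addrC; congr (_ + _).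
have -> : \sum_(j | adj G i j) copy_of G i j u = \sum_(j : neighbor G i) copy_of G i (val j) u.
  rewrite (reindex_omap (val : neighbor G i -> _) insub) /=.
    by apply: eq_bigl => k; rewrite (valP k) valK eqxx.
  by move=> k hk; rewrite insubT.
apply/matrixP => r c; rewrite (ord1 c) mxE summxE.
rewrite (reindex (@mxtens_index _ _)) /=; last first.
  by exists (@mxtens_unindex _ _) => ? _; rewrite ?mxtens_indexK ?mxtens_unindexK.
rewrite (reindex_onto (fun p : neighbor G i * 'I_K => (enum_rank p.1, p.2)) (fun p => (enum_val p.1, p.2))) /=; last first.
  by move=> [a b] _; rewrite /= enum_valK.
under eq_bigl do rewrite enum_rankK -surjective_pairing eqxx.
rewrite -(pair_bigA _ (fun (a : neighbor G i) (b : 'I_K) => castmx (mul1n K, erefl)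
    (tensmx (const_mx 1 : 'rV[R]_(deg G i)) (1%:M : 'M[R]_K)) r (mxtens_index (enum_rank a, b)) *
  y (mxtens_index (enum_rank a, b)) 0)) /=.
apply: eq_bigr => j _.
rewrite /copy_of valK mxE col_mxKd (bigD1 r) //= big1 ?addr0.
  rewrite castmxE !mxE cast_ord_id !mxtens_indexK mul1r -val_eqE /=.
  by rewrite modn_small // eqxx mul1r.
move=> k kr; rewrite castmxE !mxE cast_ord_id !mxtens_indexK mul1r -val_eqE /=.
by rewrite modn_small // val_eqE eq_sym (negPf kr) mul0r.
Qed.

End Characterizations.

(* Main.v *)
Require Import Defs.
From mathcomp Require Import all_boot all_order all_algebra.
From mathcomp Require Import all_classical all_reals all_analysis.
From mathcomp Require Import ring lra.

(* The updates are ADMM for: minimise sum Phi_i subject to M_i u_i - m_i = v_i >= 0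
   and S_ij u_i = R_ji u_j = v_ij.  Constraints being affine, Farkas' lemma applied
   to the gradient of the cost at the optimum gives multipliers mu_i for
   M_i u_i >= m_i, and the power balance part beta_i of mu_i also supplies the
   multipliers -beta_i and beta_i of the two copies of the consensus constraint.
   With L stacking all the constraint matrices, the energy
   rho |L (u - u_opt)|^2 + |lambda - lambda_opt|^2 / rho
   then decreases at each step by at least a multiple of |P (u - u_opt)|^2, by
   strong convexity; since it is nonnegative, P u converges to x_opt. *)

Set Implicit Arguments.
Unset Strict Implicit.
Unset Printing Implicit Defensive.

Local Open Scope classical_set_scope.
Local Open Scope ring_scope.

(** * Farkas' lemma for finitely many linear forms *)

(** By induction on the list of forms selected by [P]. If [g] is already nonnegative on the cone cut
    out by the tail, the head gets multiplier 0. Otherwise some [x] in that cone has [g x < 0],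
    which forces [a k x < 0] and allows projecting along [x]. Multipliers vanishing outside [P]
    later express complementary slackness. *)
Lemma farkas (R : realFieldType) (V : lmodType R) (I : finType) (P : pred I)
    (a : I -> V -> R) (g : V -> R) :
  (forall i, linear (a i : V -> R^o)) -> linear (g : V -> R^o) ->
  (forall d, (forall i, P i -> 0 <= a i d) -> 0 <= g d) ->
  exists2 mu : I -> R, (forall i, 0 <= mu i /\ (~~ P i -> mu i = 0)) &
    forall d, g d = \sum_i mu i * a i d.
Proof.
move=> la lg Hg.
suff [mu mu0 E] : exists2 mu : I -> R, (forall i, 0 <= mu i) &
    forall d, g d = \sum_(i <- enum P) mu i * a i d.
  exists (fun i => if P i then mu i else 0).
    by move=> i; case: (P i).
  move=> d; rewrite E big_enum big_mkcond; apply: eq_bigr => i _ /=.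
  by rewrite unfold_in; case: (P i); rewrite ?mul0r.
have : forall d, (forall i, i \in enum P -> 0 <= a i d) -> 0 <= g d.
  move=> d Hd; apply: Hg => i Pi; apply: Hd.
  by rewrite mem_enum.
move: (enum_uniq P) la lg {Hg}.
elim: (enum P) a g => [|k s IH] a g.
  move=> _ _ lg Hg; exists (fun=> 0) => // d; rewrite big_nil.
  have lN : g (- d) = - g d.
    by have := lg (- 1) d d; have := lg (- 1) d 0;
      rewrite !addr0 !scaleN1r /GRing.scale /= addNr; lra.
  have := Hg d; have := Hg (- d); rewrite lN oppr_ge0 => h1 h2.
  by apply/eqP; rewrite eq_le h1 ?h2.
move=> /andP[ks us] la lg Hg.
have [H|/existsNP[x /not_implyP[Hx /negP]]] :=
    pselect (forall d, (forall i, i \in s -> 0 <= a i d) -> 0 <= g d).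
  have [mu mu0 E] := IH a g us la lg H.
  exists (fun i => if i == k then 0 else mu i) => [i|d].
    by case: ifP.
  rewrite big_cons eqxx mul0r add0r E; apply: eq_big_seq => i si.
  by case: eqP => // ik; rewrite -ik si in ks.
(* The forms vanishing at x are handled by induction: red f is f precomposed
   with the projection along x onto the kernel of a k. *)
rewrite -ltNge => gx.
have kx : a k x < 0.
  rewrite ltNge; apply/negP => kx; move: gx; rewrite ltNge Hg // => i.
  by rewrite in_cons => /predU1P[->//|/Hx].
pose c d := - (a k d / a k x).
have lin f : linear (f : V -> R^o) -> forall d, f (c d *: x + d) = c d * f x + f d.
  by move=> lf d; rewrite lf.
pose red (f : V -> R) d := c d * f x + f d.
have lred f : linear (f : V -> R^o) -> linear (red f : V -> R^o).
  move=> lf t y z; rewrite /red /c lf la /GRing.scale /=.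
  by field; rewrite lt_eqF.
have [|||mu mu0 E] := IH (fun i => red (a i)) (red g) us.
- by move=> i; apply: lred.
- exact: lred.
- move=> d Hd; rewrite /red -lin //; apply: Hg => i.
  rewrite in_cons => /predU1P[->|/Hd].
    rewrite lin // /c mulNr divfK ?addNr //; first by rewrite lt_eqF.
  by rewrite /red -lin.
(* Evaluating the desired identity at [x] forces this multiplier of [k]. It is a quotient of a
   nonpositive number by a negative one, since [g x < 0] and the tail forms are nonnegative at
   [x]. *)
exists (fun i => if i == k then (g x - \sum_(j <- s) mu j * a j x) / a k x else mu i).
  move=> i; case: ifP => // _; rewrite -mulrNN -invrN mulr_ge0 ?invr_ge0 ?oppr_ge0 ?(ltW kx) //.
  rewrite subr_le0 (le_trans (ltW gx)) // big_seq sumr_ge0 // => j js.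
  by rewrite mulr_ge0 ?Hx.
move=> d; rewrite big_cons eqxx.
rewrite [X in _ + X](eq_big_seq (fun i => mu i * a i d)); last first.
  move=> j js /=; have /negPf -> // : j != k.
  by apply: contraNneq ks => <-.
have := E d; rewrite /red.
have -> : \sum_(i <- s) mu i * (c d * a i x + a i d)
  = c d * (\sum_(i <- s) mu i * a i x) + \sum_(i <- s) mu i * a i d.
  by rewrite mulr_sumr -big_split; apply: eq_bigr => i _ /=; ring.
move=> Ed; have -> : g d = - (c d * g x) + (c d * g x + g d) by ring.
rewrite Ed /c; field; by rewrite lt_eqF.
Qed.

(** * Quadratic bounds around the tangents of a scalar cost *)

(* The upper bound comes from the tangent inequality at y and the Lipschitz
   continuity of the derivative. *)
Lemma good_cost_tangent (R : realType) (f : R -> R) : good_cost f ->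
  exists m L : R, [/\ 0 < m, 0 <= L & forall x y,
    f x + derive1 f x * (y - x) + m * (y - x) ^+ 2 <= f y
      <= f x + derive1 f x * (y - x) + L * (y - x) ^+ 2].
Proof.
move=> [[m m0 Hm] [df _ lf] _].
have low x y : f x + derive1 f x * (y - x) + m / 2 * (y - x) ^+ 2 <= f y.
  have [->|yx] := eqVneq y x; first by rewrite subrr expr0n /= !mulr0 !addr0.
  have [h hE] : exists h, h = y - x by exists (y - x).
  have h0 : 0 < `|h| by rewrite normr_gt0 hE subr_eq0.
  rewrite -hE leNgt; apply/negP => gap.
  pose D := f x + derive1 f x * h + m / 2 * h ^+ 2 - f y.
  have D0 : 0 < D by rewrite subr_gt0.
  have := df x; rewrite /derivable => /cvgrPdist_lt /(_ (D / (4 * `|h|))).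
  rewrite divr_gt0 ?mulr_gt0 // => /(_ isT) [r /= r0 Hr].
  (* The three bounds on [s] serve in turn: strong convexity applies, the difference quotient is
     within [D / (4 * |h|)] of the derivative, and the loss [m / 2 * s * h ^+ 2] is at most [D / 2].
     Together they give [D <= D / 4 + D / 2], contradicting [D > 0]. *)
  pose s := Num.min 1 (Num.min (r / (2 * `|h|)) (D / (m * h ^+ 2))).
  have h20 : 0 < h ^+ 2 by rewrite exprn_even_gt0 //= -normr_gt0.
  have r1 : 0 < r / (2 * `|h|) by rewrite divr_gt0 ?mulr_gt0.
  have r2 : 0 < D / (m * h ^+ 2) := divr_gt0 D0 (mulr_gt0 m0 h20).
  have s0 : 0 < s by rewrite !lt_min ltr01 r1 r2.
  have s1 : s <= 1 by rewrite ge_min lexx.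
  have s2 : s * `|h| < r.
    have : s <= r / (2 * `|h|) by rewrite !ge_min lexx !orbT.
    by have := mulr_gt0 s0 h0; rewrite ler_pdivlMr ?mulr_gt0 //; lra.
  have s3 : m * (s * h ^+ 2) <= D.
    have : s <= D / (m * h ^+ 2) by rewrite !ge_min lexx !orbT.
    by rewrite ler_pdivlMr; [lra | exact: mulr_gt0].
  have {}Hr := Hr (s * h); rewrite /= in Hr.
  have /Hr {Hr} : `|0 - s * h| < r by rewrite sub0r normrN normrM gtr0_norm.
  have sh0 : s * h != 0 by apply: mulf_neq0; [rewrite gt_eqF | rewrite -normr_gt0].
  move=> /(_ sh0).
  rewrite -[lim _]/('D_1 f x) -derive1E /GRing.scale /= mulr1.
  have := Hm y x s; rewrite (ltW s0) s1 => /(_ isT).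
  have -> : s * y + (1 - s) * x = s * h + x by rewrite hE; ring.
  rewrite -hE => conv; rewrite ltr_pdivlMr ?mulr_gt0 // => dist.
  set q := (s * h)^-1 * _ in dist.
  have qE : f (s * h + x) = f x + s * h * q by rewrite /q mulVKf //; ring.
  have : (derive1 f x - q) * h <= D / 4.
    by apply: le_trans (ler_norm _) _; rewrite normrM; lra.
  have : q * h <= f y - f x - m / 2 * (1 - s) * h ^+ 2.
    rewrite -(ler_pM2l s0); move: conv; rewrite qE; lra.
  move: s3 D0; rewrite /D; lra.
have [L lL] : exists L, forall x y, `|derive1 f x - derive1 f y| <= L * `|x - y|.
  have [|L HL] := (ex_dom_bound _ _).1 lf.
    exact: (@globally_properfilter _ _ (0, 0)).
  by exists L => x y; exact: (HL (x, y)).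
(* The sign of [L] is not recorded by the Lipschitz bound, hence the absolute value. *)
exists (m / 2), `|L|; split=> [||x y]; rewrite ?divr_gt0 //.
apply/andP; split; first exact: low.
have := low y x.
have : (derive1 f y - derive1 f x) * (y - x) <= `|L| * (y - x) ^+ 2.
  apply: le_trans (ler_norm _) _; rewrite normrM -real_normK ?num_real // expr2 mulrA.
  apply: ler_wpM2r => //; apply: le_trans (lL _ _) _.
  by apply: ler_wpM2r => //; exact: ler_norm.
have : 0 <= m / 2 * (x - y) ^+ 2 by rewrite mulr_ge0 ?sqr_ge0 // divr_ge0 // ltW.
lra.
Qed.

(** * Convergence criteria *)

Lemma cvg_mx_entry (R : realType) (m n : nat) (u : nat -> 'M[R]_(m, n))
    (l : 'M[R]_(m, n)) :
  (forall i j, (fun k => u k i j) @ \oo --> l i j) -> u @ \oo --> l.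
Proof.
move=> H; apply/cvgrPdist_le => /= e e0; near=> k.
rewrite /Num.Def.normr/= mx_normrE (bigmax_le _ (ltW e0))//= => ij _.
rewrite !mxE.
move: ij; near: k; apply: filter_forall => /= ij.
exact: ((cvgrPdist_le _ _).1 (H ij.1 ij.2)).
Unshelve. all: by end_near. Qed.

(** [V] is nonincreasing and bounded below, hence convergent; its consecutive differences tend to 0
    and squeeze the squared error. *)
Lemma cvg_of_telescoping_bound (R : realType) (c l : R) (x V : nat -> R) :
  0 < c -> (forall s, 0 <= V s) ->
  (forall s, c * (x s.+1 - l) ^+ 2 <= V s - V s.+1) -> x @ \oo --> l.
Proof.
move=> c0 V0 H.
have cV : cvgn V.
  apply: nonincreasing_is_cvgn; last by exists 0 => _ [s _ <-].
  apply/nonincreasing_seqP => s; rewrite -subr_ge0 (le_trans _ (H s)) //.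
  by rewrite mulr_ge0 ?sqr_ge0 // ltW.
have dV : (fun s => V s - V s.+1) @ \oo --> (0 : R).
  rewrite -(subrr (limn V)); apply: cvgB => //.
  by rewrite (cvg_shiftS V).
rewrite -cvg_shiftS; apply/cvgrPdist_lt => e e0.
have ce : 0 < c * e ^+ 2 by rewrite mulr_gt0 ?exprn_gt0.
move/cvgr_lt : dV => /(_ _ ce).
apply: filterS => s /(le_lt_trans (H s)) /=.
by rewrite ltr_pM2l // -real_normK ?num_real // ltr_pXn2r ?nnegrE ?(ltW e0) // distrC.
Qed.

(** * First-order conditions from quadratic bounds, and feasible steps *)

Lemma ge0_of_quadratic_right (R : realFieldType) (A B t0 : R) : 0 < t0 ->
  (forall t, 0 < t <= t0 -> 0 <= t * A + t ^+ 2 * B) -> 0 <= A.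
Proof.
move=> t00 H; rewrite leNgt; apply/negP => A0.
(* For this [t], [t * B < - A], so [A + t * B] is negative. *)
pose t := Num.min t0 (- A / (1 + `|B|)).
have B1 : 0 < 1 + `|B| by rewrite ltr_pwDl.
have t_gt0 : 0 < t by rewrite lt_min t00 divr_gt0 ?oppr_gt0.
have tB : t * (1 + `|B|) <= - A.
  by rewrite -ler_pdivlMr // ge_min lexx orbT.
have := H t; rewrite t_gt0 ge_min lexx => /(_ isT).
rewrite expr2 -mulrA -mulrDr pmulr_rge0 //.
have : t * B <= t * `|B| by rewrite ler_pM2l // ler_norm.
lra.
Qed.

Lemma eq0_of_quadratic (R : realFieldType) (A B : R) :
  (forall t, 0 <= t * A + t ^+ 2 * B) -> A = 0.
Proof.
move=> H; apply/eqP; rewrite eq_le; apply/andP; split.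
  rewrite -oppr_ge0; apply: (@ge0_of_quadratic_right _ _ B 1) => // t _.
  by have := H (- t); rewrite sqrrN mulrN mulNr.
by apply: (@ge0_of_quadratic_right _ _ B 1) => // t _.
Qed.

(** Here [b] is the slack of affine constraints at a point and [a] its slope along a direction.
    Tight constraints do not decrease; the others leave room for a common short step. *)
Lemma small_step_feasible (R : realFieldType) (I : finType) (b a : I -> R) :
  (* The step length comes from [S], which dominates every ratio [|a i| / b i] with [b i > 0]; the
     terms with [b i = 0] count as 0 because division by 0 yields 0. *)
  (forall i, 0 <= b i) -> (forall i, b i = 0 -> 0 <= a i) ->
  exists2 t0 : R, 0 < t0 & forall t, 0 < t <= t0 -> forall i, 0 <= b i + t * a i.
Proof.
move=> b0 ba; pose S := \sum_i `|a i| / b i.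
have S0 : 0 <= S by apply: sumr_ge0 => i _; rewrite divr_ge0.
exists (1 + S)^-1 => [|t /andP[t_gt0 tS] i]; first by rewrite invr_gt0; lra.
have [bi0|bi0] := eqVneq (b i) 0.
  by rewrite bi0 add0r mulr_ge0 ?(ltW t_gt0) ?ba.
have bi : 0 < b i by rewrite lt_neqAle eq_sym bi0 b0.
have aS : `|a i| / b i <= S.
  by rewrite /S (bigD1 i) //= lerDl sumr_ge0 // => j _; rewrite divr_ge0.
have : t * (1 + S) <= 1 by rewrite -ler_pdivlMr ?mul1r //; lra.
have : t * (`|a i| / b i) <= t * S by rewrite ler_pM2l.
have : t * (`|a i| / b i) * b i = t * `|a i| by rewrite -mulrA divfK.
have : t * - a i <= t * `|a i| by rewrite ler_pM2l // ler_normr lexx orbT.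
set q := t * (`|a i| / b i) => h1 h2 h3 h4.
have : q * b i <= b i by rewrite ler_piMl ?b0 //; lra.
lra.
Qed.

(** * Inner product of column vectors *)

Section Dot.
Context {R : realType}.

Definition dot {n} (a b : 'cV[R]_n) : R := \sum_r a r 0 * b r 0.

Lemma dotDr n (a b c : 'cV[R]_n) : dot a (b + c) = dot a b + dot a c.
Proof. by rewrite /dot -big_split; apply: eq_bigr => r _; rewrite mxE mulrDr. Qed.

Lemma dotDl n (a b c : 'cV[R]_n) : dot (a + b) c = dot a c + dot b c.
Proof. by rewrite /dot -big_split; apply: eq_bigr => r _; rewrite mxE mulrDl. Qed.

Lemma dotZr n (t : R) (a b : 'cV[R]_n) : dot a (t *: b) = t * dot a b.
Proof. by rewrite /dot mulr_sumr; apply: eq_bigr => r _; rewrite mxE mulrCA. Qed.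

Lemma dotNl n (a b : 'cV[R]_n) : dot (- a) b = - dot a b.
Proof. by rewrite /dot -sumrN; apply: eq_bigr => r _; rewrite mxE mulNr. Qed.

Lemma dotBl n (a b c : 'cV[R]_n) : dot (a - b) c = dot a c - dot b c.
Proof. by rewrite dotDl dotNl. Qed.

Lemma dotZl n (t : R) (a b : 'cV[R]_n) : dot (t *: a) b = t * dot a b.
Proof. by rewrite /dot mulr_sumr; apply: eq_bigr => r _; rewrite mxE mulrA. Qed.

Lemma dot_sumr n I (s : seq I) (P : pred I) (a : 'cV[R]_n) (b : I -> 'cV[R]_n) :
  dot a (\sum_(i <- s | P i) b i) = \sum_(i <- s | P i) dot a (b i).
Proof.
elim/big_rec2: _ => [|i x y _ <-]; last exact: dotDr.
by rewrite -(scale0r (0 : 'cV[R]_n)) dotZr mul0r.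
Qed.

Lemma dot_col_mx m n (a : 'cV[R]_(m + n)) (b : 'cV[R]_m) (c : 'cV[R]_n) :
  dot a (col_mx b c) = dot (usubmx a) b + dot (dsubmx a) c.
Proof.
by rewrite /dot big_split_ord; congr (_ + _); apply: eq_bigr => r _;
  rewrite ?col_mxEu ?col_mxEd mxE.
Qed.

Lemma enorm_sqrD n (c b : 'cV[R]_n) (t : R) :
  enorm (c + t *: b) ^+ 2 = enorm c ^+ 2 + t * (2 * dot c b) + t ^+ 2 * dot b b.
Proof.
have E (x : 'cV[R]_n) : enorm x ^+ 2 = \sum_r x r 0 ^+ 2.
  by rewrite /enorm sqr_sqrtr // sumr_ge0 // => r _; rewrite sqr_ge0.
rewrite !E /dot !mulr_sumr -!big_split; apply: eq_bigr => r _ /=.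
by rewrite !mxE; ring.
Qed.

End Dot.

(** * Descent of the ADMM energy, one constraint block at a time *)

Section Energy.
Context {R : realType} (rho : R) (rho0 : 0 < rho).

(** Here [a] is the current value of the constrained expression and [lam] its multiplier; [as_] and
    [lams] are their values at the optimum. *)
Definition energy {n} (a as_ lam lams : 'cV[R]_n) : R :=
  \sum_r (rho * (a r 0 - as_ r 0) ^+ 2 + rho^-1 * (lam r 0 - lams r 0) ^+ 2).

Lemma energy_ge0 n (a as_ lam lams : 'cV[R]_n) : 0 <= energy a as_ lam lams.
Proof.
apply: sumr_ge0 => r _.
by rewrite addr_ge0 // mulr_ge0 ?sqr_ge0 ?invr_ge0 // ltW.
Qed.

(* The difference of the two sides is the square of
   rho (a - a') + (lam - lam') divided by rho. *)
Lemma energy_descent_coordinate (a a' as_ m lam lam' lams v : R) :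
  lam' = lam - rho * (a' - m - v) ->
  2 * ((lam' - lams) * (a' - as_))
    <= rho * (a - as_) ^+ 2 + rho^-1 * (lam - lams) ^+ 2
       - (rho * (a' - as_) ^+ 2 + rho^-1 * (lam' - lams) ^+ 2)
       + 2 * ((rho * (v - (a - m - rho^-1 * lam)) - lams) * (v - (as_ - m))).
Proof.
move=> ->; rewrite -subr_ge0.
set D := (X in 0 <= X).
have -> : D = rho^-1 * (rho * (a - a') + rho * (a' - m - v)) ^+ 2.
  by rewrite /D; field; rewrite gt_eqF.
by rewrite mulr_ge0 ?sqr_ge0 ?invr_ge0 // ltW.
Qed.

(** The update of [v] projects [z = a - m - lam / rho] onto the nonnegative orthant, so
    [(v - z) * (v - (as_ - m)) <= 0] in each coordinate. By complementarity
    [lams * (v - (as_ - m)) = lams * v >= 0]. Hence the last term of the coordinate inequality is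
    nonpositive. *)
Lemma energy_descent_nonneg n (a a' as_ m lam lam' lams : 'cV[R]_n) v :
  v = pospart (a - m - rho^-1 *: lam) ->
  lam' = lam - rho *: (a' - m - v) ->
  (forall r, [/\ 0 <= lams r 0, 0 <= (as_ - m) r 0
               & lams r 0 * (as_ - m) r 0 = 0]) ->
  2 * dot (lam' - lams) (a' - as_)
    <= energy a as_ lam lams - energy a' as_ lam' lams.
Proof.
move=> vE lE H; rewrite /dot mulr_sumr -sumrB; apply: ler_sum => r _.
have := @energy_descent_coordinate (a r 0) (a' r 0) (as_ r 0) (m r 0)
  (lam r 0) (lam' r 0) (lams r 0) (v r 0).
rewrite lE !mxE => /(_ erefl) /le_trans; apply.
have [] := H r; rewrite !mxE => l0 a0 la.
rewrite gerDl pmulr_rle0 //.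
have -> : v r 0 = Num.max (a r 0 - m r 0 - rho^-1 * lam r 0) 0.
  by rewrite vE !mxE.
set z := _ - rho^-1 * _.
have E w : (rho * (w - z) - lams r 0) * (w - (as_ r 0 - m r 0)) =
  rho * ((w - z) * w) - rho * ((w - z) * (as_ r 0 - m r 0)) - lams r 0 * w.
  by rewrite -[RHS]addr0 -[in RHS]la; ring.
rewrite E; have [z0|z0] := lerP z 0.
  have : 0 <= rho * ((0 - z) * (as_ r 0 - m r 0)).
    by rewrite !mulr_ge0 ?(ltW rho0) // sub0r oppr_ge0.
  lra.
rewrite subrr !mul0r !mulr0 !add0r oppr0 add0r oppr_le0 mulr_ge0 //; exact: ltW.
Qed.

(** As [v] averages [a1 - l1 / rho] and [a2 - l2 / rho], and the optimal multipliers are opposite,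
    the last terms of the two coordinate inequalities cancel. *)
Lemma energy_descent_consensus n (a1 a1' a2 a2' as_ l1 l1' l2 l2' lams v : 'cV[R]_n) :
  v = 2^-1 *: (a1 - rho^-1 *: l1 + a2 - rho^-1 *: l2) ->
  l1' = l1 - rho *: (a1' - v) -> l2' = l2 - rho *: (a2' - v) ->
  2 * (dot (l1' - lams) (a1' - as_) + dot (l2' + lams) (a2' - as_))
    <= (energy a1 as_ l1 lams + energy a2 as_ l2 (- lams))
       - (energy a1' as_ l1' lams + energy a2' as_ l2' (- lams)).
Proof.
move=> vE E1 E2; rewrite /dot -big_split -!big_split -sumrB mulr_sumr.
apply: ler_sum => r _ /=; rewrite mulrDr.
have vr : v r 0 = 2^-1 * (a1 r 0 - rho^-1 * l1 r 0 + a2 r 0 - rho^-1 * l2 r 0).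
  by rewrite vE !mxE.
have l1r : l1' r 0 = l1 r 0 - rho * (a1' r 0 - 0 - v r 0).
  by rewrite E1 !mxE subr0.
have l2r : l2' r 0 = l2 r 0 - rho * (a2' r 0 - 0 - v r 0).
  by rewrite E2 !mxE subr0.
have := @energy_descent_coordinate (a2 r 0) _ (as_ r 0) _ _ _ (- lams r 0) _ l2r.
have := @energy_descent_coordinate (a1 r 0) _ (as_ r 0) _ _ _ (lams r 0) _ l1r.
have : (rho * (v r 0 - (a1 r 0 - 0 - rho^-1 * l1 r 0)) - lams r 0)
    * (v r 0 - (as_ r 0 - 0))
  + (rho * (v r 0 - (a2 r 0 - 0 - rho^-1 * l2 r 0)) - - lams r 0)
    * (v r 0 - (as_ r 0 - 0)) = 0.
  by rewrite vr; field; rewrite gt_eqF.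
rewrite !mxE; lra.
Qed.

End Energy.

(** * Separability, gradient and strong monotonicity of the cost *)

Lemma big_quantity (V : finType) (R : nmodType) (F : quantity V -> R) :
  \sum_q F q = F Pq + F Rampq + F Ecq + F Edq + F SoCq + \sum_j F (Fq j).
Proof.
rewrite (bigD1 Pq) // (bigD1 Rampq) // (bigD1 Ecq) // (bigD1 Edq) //.
rewrite (bigD1 SoCq) //= !addrA; congr (_ + _).
rewrite (reindex_omap (@Fq V) (fun q => if q is Fq j then Some j else None)) /=.
  by apply: eq_bigl => j; rewrite eqxx.
by case.
Qed.

Section Cost.
Context {R : realType} (G : microgrid R).
Local Notation bus := 'I_(nbus G).
Local Notation K := (horizon G).

Definition cost (i : bus) (q : quantity bus) : R -> R :=
  match q with
  | Pq => Phig G i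
  | Ecq => Phic G i
  | Edq => Phid G i
  | Fq j => Phif G i j
  | Rampq | SoCq => fun=> 0
  end.

Definition coord_cost (i : bus) (k : 'I_(nvar G i)) : R -> R :=
  cost i (\val (enum_val k : variable G i)).1.

(** Separability lets the scalar tangent bounds be summed coordinate by coordinate and identifies
    [gradPhi] as the gradient of [Phi]. *)
Lemma PhiE (i : bus) (x : 'cV[R]_(nvar G i)) :
  Phi G i x = \sum_k coord_cost k (x k 0).
Proof.
pose H (q : quantity bus) (t : 'I_K) := cost i q (varval G i x q t).
transitivity (\sum_(p : quantity bus * 'I_K | is_variable G i p.1) H p.1 p.2).
  rewrite /Phi big_mkord.
  rewrite [RHS]big_mkcond.
  rewrite -(pair_bigA _ (fun q t => if is_variable G i q then H q t else 0)).
  rewrite exchange_big; apply: eq_bigr => t _.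
  rewrite big_quantity /= /H /= !addr0 -big_mkcond.
  by congr (_ + _); case: ifP => _; case: ifP => _; rewrite ?addr0 ?addrA.
transitivity (\sum_(a : variable G i) H (val a).1 (val a).2).
  rewrite (reindex_omap (val : variable G i -> _) insub) /=.
    by apply: eq_bigl => a; rewrite (valP a) valK eqxx.
  by move=> p hp; rewrite insubT.
rewrite (reindex (@enum_val _ (fun _ : variable G i => true))) /=; last first.
  by apply: onW_bij; exact: enum_val_bij.
apply: eq_bigr => k _; rewrite /H /coord_cost.
have -> : varval G i x (val (enum_val k : variable G i)).1
    (val (enum_val k : variable G i)).2 = x k 0; last by [].
by rewrite /varval valK -surjective_pairing valK enum_valK.
Qed.

Definition gradPhi (i : bus) (x : 'cV[R]_(nvar G i)) : 'cV[R]_(nvar G i) :=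
  \col_k derive1 (coord_cost k) (x k 0).

Lemma Phi_tangent (i : bus) : good_costs G ->
  exists m L : 'I_(nvar G i) -> R, (forall k, 0 < m k) /\ forall x y,
    Phi G i x + dot (gradPhi x) (y - x) + \sum_k m k * (y - x) k 0 ^+ 2
      <= Phi G i y
      <= Phi G i x + dot (gradPhi x) (y - x) + \sum_k L k * (y - x) k 0 ^+ 2.
Proof.
move=> [hg hc hd hf].
have gk (k : 'I_(nvar G i)) : good_cost (coord_cost k).
  rewrite /coord_cost; case: (enum_val k) => [[q t] /=].
  by case: q => //= [/hg|/hc|/hd|j /hf].
have [m mP] := choice (fun k => good_cost_tangent (gk k)).
have [L LP] := choice mP.
exists m, L; split=> [k|x y]; first by have [] := LP k.
rewrite !PhiE /dot -!big_split /=.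
by apply/andP; split; apply: ler_sum => k _; have [_ _ /(_ (x k 0) (y k 0))] := LP k;
  rewrite !mxE => /andP[].
Qed.

(** Adding the lower tangent bounds at [x] and at [y] cancels the costs; one of the two quadratic
    terms is then dropped. *)
Lemma gradPhi_strongly_monotone : good_costs G ->
  exists2 m : forall i, 'I_(nvar G i) -> R, forall i k, 0 < m i k &
    forall i (x y : 'cV[R]_(nvar G i)),
      \sum_k m i k * (y - x) k 0 ^+ 2 <= dot (gradPhi y - gradPhi x) (y - x).
Proof.
move=> gc.
have H i : exists2 m : 'I_(nvar G i) -> R, forall k, 0 < m k &
    forall x y : 'cV[R]_(nvar G i),
    \sum_k m k * (y - x) k 0 ^+ 2 <= dot (gradPhi y - gradPhi x) (y - x).
  have [m [L [m0 mL]]] := Phi_tangent i gc; exists m => // x y.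
  have /andP[h1 _] := mL x y; have /andP[h2 _] := mL y x.
  have : 0 <= \sum_k m k * (x - y) k 0 ^+ 2.
    by apply: sumr_ge0 => k _; rewrite mulr_ge0 ?sqr_ge0 // ltW.
  have xyE : x - y = -1 *: (y - x) by rewrite scaleN1r opprB.
  move: h1 h2; rewrite xyE dotBl dotZr; lra.
exists (fun i => s2val (cid2 (H i))) => i; first exact: (s2valP (cid2 (H i))).
exact: (s2valP' (cid2 (H i))).
Qed.

End Cost.

(** * Multipliers at the optimum *)

Section KKT.
Context {R : realType} (G : microgrid R).
Local Notation bus := 'I_(nbus G).
Local Notation K := (horizon G).
Local Notation state := (forall i : bus, 'cV[R]_(nvar G i)).

(* The vectors u_i whose copies agree with the flows they stand for. *)
Definition consistent (x : state) (i : bus) : 'cV[R]_(ndim G i) :=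
  col_mx (x i) (\col_p
    let: (a, t) := mxtens_unindex p in
    let j := val (enum_val a : neighbor G i) in Flow G j (x j) i t).

Lemma usubmx_consistent x i : usubmx (consistent x i) = x i.
Proof. exact: col_mxKu. Qed.

Lemma consistent_linear (a : R) (x y : state) i :
  consistent (fun i => a *: x i + y i) i = a *: consistent x i + consistent y i.
Proof.
rewrite /consistent scale_col_mx add_col_mx; congr col_mx.
apply/matrixP => p c; rewrite !mxE; case: (mxtens_unindex p) => b t.
by rewrite /Flow varval_linear.
Qed.

Lemma copy_of_consistent (x : state) i j : adj G i j ->
  copy_of G i j (consistent x i) = \col_t Flow G j (x j) i t.
Proof.
move=> ij; apply/matrixP => t c; rewrite /copy_of insubT mxE col_mxKd !mxE.
by rewrite mxtens_indexK enum_rankK.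
Qed.

Lemma Mmx_mul_block (i : bus) (u : 'cV[R]_(ndim G i)) :
  Mmx G i *m u - mvec G i =
  col_mx (avec G i - Amx G i *m usubmx u)
   (bvec G i - Bmx G i i *m usubmx u + \sum_(j | adj G i j) copy_of G i j u).
Proof. by rewrite -{1 4}(vsubmxK u) Mmx_mul. Qed.

(** For a neighbor [j], [- Bmx G j i *m x j] is the flow from [j] to [i], which is exactly the copy
    held in [consistent x i]; so both sides speak of the same slacks. *)
Lemma MF_feasibleE (x : state) : irreflexive (adj G) ->
  MF_feasible G x <->
  forall i r, 0 <= (Mmx G i *m consistent x i - mvec G i) r 0.
Proof.
move=> irr.
have E i : Mmx G i *m consistent x i - mvec G i = col_mx
    (avec G i - Amx G i *m x i)
    (bvec G i - (Bmx G i i *m x i + \sum_(j | adj G i j) Bmx G j i *m x j)).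
  rewrite Mmx_mul_block usubmx_consistent; congr col_mx.
  rewrite opprD addrA; congr (_ + _); rewrite -sumrN; apply: eq_bigr => j ij.
  rewrite copy_of_consistent // Bmx_off_mul; last first.
    by apply: contraTneq ij => ->; rewrite irr.
  by apply/matrixP => t c; rewrite !mxE opprK.
split=> H i.
  move=> r; rewrite E; have [hA hB] := H i; rewrite mxE.
  case: splitP => k _.
    by have := hA k; rewrite [X in _ -> _ <= X]mxE [X in _ -> _ <= _ + X]mxE subr_ge0.
  by have := hB k; rewrite [X in _ -> _ <= X]mxE [X in _ -> _ <= _ + X]mxE subr_ge0.
split=> r.
  by have := H i (lshift _ r); rewrite E col_mxEu mxE [X in _ + X]mxE subr_ge0.
by have := H i (rshift _ r); rewrite E col_mxEd mxE [X in _ + X]mxE subr_ge0.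
Qed.

(** A direction along which no tight constraint decreases stays feasible for a short step, so
    optimality makes the derivative of the cost along it nonnegative. Farkas over the tight
    constraints gives the multipliers; their vanishing elsewhere is complementary slackness. *)
Lemma optimal_multipliers (x : state) : irreflexive (adj G) -> good_costs G ->
  MF_optimal G x ->
  exists mu : forall i, 'cV[R]_(ncon G i + K),
    (forall i r, [/\ 0 <= mu i r 0, 0 <= (Mmx G i *m consistent x i - mvec G i) r 0
       & mu i r 0 * (Mmx G i *m consistent x i - mvec G i) r 0 = 0]) /\
    forall d : state, \sum_i dot (gradPhi (x i)) (d i)
      = \sum_i dot (mu i) (Mmx G i *m consistent d i).
Proof.
move=> irr gc [xf xopt].
have slack0 := (MF_feasibleE x irr).1 xf.
(* Farkas requires a single index type and a single vector space: constraints of all agents are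
   indexed by pairs, and all the [x i] are stacked into one column. *)
pose I : finType := {i : bus & 'I_(ncon G i + K)}.
pose slack (p : I) := (Mmx G (tag p) *m consistent x (tag p) - mvec G (tag p)) (tagged p) 0.
pose V := 'cV[R]_(\sum_i nvar G i).
pose part (z : V) : state := fun i => submxcol z i.
pose a (p : I) (z : V) := (Mmx G (tag p) *m consistent (part z) (tag p)) (tagged p) 0.
pose g (z : V) := \sum_i dot (gradPhi (x i)) (part z i).
have part_lin t (y z : V) i : part (t *: y + z) i = t *: part y i + part z i.
  by apply/matrixP => r c; rewrite !mxE.
have cpart_lin t (y z : V) i : consistent (part (t *: y + z)) i =
    t *: consistent (part y) i + consistent (part z) i.
  rewrite -consistent_linear; congr (consistent _ i).
  by apply: functional_extensionality_dep => k; exact: part_lin.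
have la p : linear (a p : V -> R^o).
  by move=> t y z; rewrite /a cpart_lin mulmxDr -scalemxAr !mxE.
have lg : linear (g : V -> R^o).
  move=> t y z; rewrite /g /GRing.scale /= mulr_sumr -big_split.
  by apply: eq_bigr => i _; rewrite part_lin dotDr dotZr.
have [|mu mu0 muE] := @farkas _ _ _ (fun p => slack p == 0) _ _ la lg.
  move=> z Hz.
  have [|p /eqP /Hz //|t0 t00 Ht] := @small_step_feasible _ I slack (fun p => a p z).
    by move=> p; exact: slack0.
  have [L HL] : exists L : forall i, 'I_(nvar G i) -> R, forall i y,
      Phi G i y <= Phi G i (x i) + dot (gradPhi (x i)) (y - x i)
        + \sum_k L i k * (y - x i) k 0 ^+ 2.
    have HL i : exists L : 'I_(nvar G i) -> R, forall y,
        Phi G i y <= Phi G i (x i) + dot (gradPhi (x i)) (y - x i)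
          + \sum_k L k * (y - x i) k 0 ^+ 2.
      have [m [L [_ mL]]] := Phi_tangent i gc.
      by exists L => y; have /andP[] := mL (x i) y.
    by exists (fun i => sval (cid (HL i))) => i; exact: (svalP (cid (HL i))).
  (* Comparing [x] with the feasible point [x + t z], and bounding the cost of the latter by its
     upper tangent bound, gives the quadratic inequality whose linear coefficient is [g z]. *)
  apply: (@ge0_of_quadratic_right _ _
    (\sum_i \sum_k L i k * part z i k 0 ^+ 2) t0) => // t ht.
  pose y i := t *: part z i + x i.
  have /xopt : MF_feasible G y.
    apply/MF_feasibleE => // i r; have := Ht t ht (existT _ i r).
    rewrite /slack /a /= [consistent y i]consistent_linear mulmxDr -scalemxAr.
    by rewrite !mxE; lra.
  have : \sum_i Phi G i (y i) <= \sum_i (Phi G i (x i)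
      + (t * dot (gradPhi (x i)) (part z i)
         + t ^+ 2 * \sum_k L i k * part z i k 0 ^+ 2)).
    apply: ler_sum => i _; apply: le_trans (HL i _) _.
    rewrite /y addrK dotZr -addrA lerD2l lerD2l mulr_sumr; apply: ler_sum => k _.
    by rewrite mxE exprMn mulrCA.
  rewrite !big_split /= -!mulr_sumr => h1 h2; have := le_trans h2 h1.
  by rewrite lerDl.
exists (fun i => \col_r mu (existT _ i r)); split.
  move=> i r; have [mu1 mu2] := mu0 (existT _ i r); rewrite !mxE.
  have := slack0 i r; rewrite !mxE; split=> //.
  have [sl|/mu2->] := eqVneq (slack (existT _ i r)) 0; last by rewrite mul0r.
  by move: sl; rewrite /slack /= !mxE => ->; rewrite mulr0.
move=> d; have := muE (\mxcol_i d i); rewrite /g.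
have dE : part (\mxcol_i d i) = d.
  by apply: functional_extensionality_dep => i; rewrite /part mxcolK.
rewrite dE => ->.
transitivity (\sum_i \sum_(r < ncon G i + K)
    mu (existT _ i r) * a (existT _ i r) (\mxcol_i d i)).
  by rewrite sig_big_dep /=; apply: eq_bigr => -[i r].
apply: eq_bigr => i _; apply: eq_bigr => r _.
by rewrite mxE /a dE.
Qed.

(** Used to move the terms in [R_ij u_i] from their owner [i] to the neighbor [j] holding the copy,
    next to the terms in [S_ji u_j]. *)
Lemma sum_adj_swapD (A B : bus -> bus -> R) : symmetric (adj G) ->
  \sum_i \sum_(j | adj G i j) (A i j + B i j)
  = \sum_i \sum_(j | adj G i j) (A i j + B j i).
Proof.
move=> sym.
have splitE (F H : bus -> bus -> R) : \sum_i \sum_(j | adj G i j) (F i j + H i j)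
    = \sum_i \sum_(j | adj G i j) F i j + \sum_i \sum_(j | adj G i j) H i j.
  by rewrite -big_split; apply: eq_bigr => i _; rewrite big_split.
rewrite !splitE; congr (_ + _).
rewrite (exchange_big_dep predT) //=; apply: eq_bigr => i _.
by apply: eq_bigl => j; rewrite sym.
Qed.

(* The multiplier of S_ij u_i = v_ij is minus that of the power balance of i,
   and the multiplier of R_ji u_j = v_ij is its opposite. *)
Lemma consensus_multipliers (x : state) (mu : forall i, 'cV[R]_(ncon G i + K)) :
  symmetric (adj G) ->
  (forall d : state, \sum_i dot (gradPhi (x i)) (d i)
      = \sum_i dot (mu i) (Mmx G i *m consistent d i)) ->
  forall w : forall i, 'cV[R]_(ndim G i),
    \sum_i dot (gradPhi (x i)) (usubmx (w i))
    = \sum_i dot (mu i) (Mmx G i *m w i)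
      + \sum_i \sum_(j | adj G i j)
          (dot (- dsubmx (mu i)) (Smx G i j *m w i)
           - dot (- dsubmx (mu i)) (Rmx G j i *m w j)).
Proof.
move=> sym H w; rewrite H -big_split; apply: eq_bigr => i _ /=.
set d := fun i => usubmx (w i).
(* Replacing the copies in [w i] by the true flows changes only the power balance block, and by
   exactly the consensus mismatch. *)
have -> : Mmx G i *m consistent d i = Mmx G i *m w i
    + col_mx 0 (\sum_(j | adj G i j) (Rmx G j i *m w j - Smx G i j *m w i)).
  apply: (addIr (- mvec G i)); rewrite addrAC !Mmx_mul_block add_col_mx addr0.
  rewrite usubmx_consistent -/(d i); congr col_mx.
  rewrite -[RHS]addrA -big_split; congr (_ + _); apply: eq_bigr => j ij /=.
  by rewrite copy_of_consistent // Rmx_mul Smx_mul [RHS]addrC subrK.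
rewrite dotDr dot_col_mx dot_sumr; congr (_ + _).
rewrite -(scale0r (0 : 'cV[R]_(ncon G i))) dotZr mul0r add0r.
apply: eq_bigr => j _.
by rewrite !dotNl -scaleN1r dotDr dotZr; ring.
Qed.

End KKT.

(** * Stationarity of the primal update *)

Section Stationarity.
Context {R : realType} (G : microgrid R) (rho : R).
Context (rho0 : 0 < rho) (gc : good_costs G).
Local Notation bus := 'I_(nbus G).
Local Notation K := (horizon G).

(** The gradient of each penalty at [u] is minus the multiplier after its dual update, so the
    first-order condition of the primal step is the stationarity condition with the new
    multipliers. *)
Lemma argmin_stationary (i : bus) (v lam : 'cV[R]_(ncon G i + K))
    (v1 v2 lam1 lam2 : bus -> 'cV[R]_K) (u : 'cV[R]_(ndim G i)) :
  is_argmin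
    (fun w : 'cV[R]_(ndim G i) =>
       Phihat G i w
       + rho / 2 * enorm (Mmx G i *m w - v - mvec G i - rho^-1 *: lam) ^+ 2
       + rho / 2 *
           \sum_(j | adj G i j)
             (enorm (Smx G i j *m w - v1 j - rho^-1 *: lam1 j) ^+ 2
              + enorm (Rmx G i j *m w - v2 j - rho^-1 *: lam2 j) ^+ 2)) u ->
  forall d, dot (gradPhi (usubmx u)) (usubmx d)
    = dot (lam - rho *: (Mmx G i *m u - mvec G i - v)) (Mmx G i *m d)
      + \sum_(j | adj G i j)
          (dot (lam1 j - rho *: (Smx G i j *m u - v1 j)) (Smx G i j *m d)
           + dot (lam2 j - rho *: (Rmx G i j *m u - v2 j)) (Rmx G i j *m d)).
Proof.
move=> umin d.
have multiplierE n (a y l : 'cV[R]_n) : l - rho *: (a - y) = - rho *: (a - y - rho^-1 *: l).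
  by apply/matrixP => r c; rewrite !mxE; field; rewrite gt_eqF.
have [m [L [_ mL]]] := Phi_tangent i gc.
set c0 := Mmx G i *m u - v - mvec G i - rho^-1 *: lam in umin *.
set c1 := fun j => Smx G i j *m u - v1 j - rho^-1 *: lam1 j.
set c2 := fun j => Rmx G i j *m u - v2 j - rho^-1 *: lam2 j.
have shift n (A : 'M[R]_(n, ndim G i)) t y z : A *m (u + t *: d) - y - z
    = (A *m u - y - z) + t *: (A *m d).
  by rewrite mulmxDr -scalemxAr !(addrAC _ (t *: _)).
(* Along [u + t *: d] the objective exceeds its value at [u] by at most [t * A + t ^+ 2 * B];
   minimality holds for both signs of [t], so [A = 0]. *)
pose A := dot (gradPhi (usubmx u)) (usubmx d) + rho * (dot c0 (Mmx G i *m d)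
    + \sum_(j | adj G i j) (dot (c1 j) (Smx G i j *m d) + dot (c2 j) (Rmx G i j *m d))).
pose B := \sum_k L k * usubmx d k 0 ^+ 2 + rho / 2 * (dot (Mmx G i *m d) (Mmx G i *m d)
    + \sum_(j | adj G i j) (dot (Smx G i j *m d) (Smx G i j *m d)
                            + dot (Rmx G i j *m d) (Rmx G i j *m d))).
suff /eq0_of_quadratic : forall t : R, 0 <= t * A + t ^+ 2 * B.
  rewrite /A => A0.
  have -> : Mmx G i *m u - mvec G i - v = Mmx G i *m u - (v + mvec G i).
    by rewrite -addrA -opprD [mvec _ _ + _]addrC.
  rewrite multiplierE opprD addrA -/c0 dotZl.
  under eq_bigr => j _ do
    rewrite !multiplierE -/(c1 j) -/(c2 j) !dotZl -mulrDr.
  rewrite -mulr_sumr -mulrDr mulNr; lra.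
move=> t; rewrite /A /B; have /= := umin (u + t *: d).
rewrite /Phihat shift (addrAC _ (t *: _)) -/c0 enorm_sqrD.
under [X in _ <= _ + _ * X -> _]eq_bigr => j _ do
  rewrite !shift -/(c1 j) -/(c2 j) !enorm_sqrD.
have /andP[_] := mL (usubmx u) (usubmx (u + t *: d)).
have -> : usubmx (u + t *: d) - usubmx u = t *: usubmx d.
  by apply/matrixP => r c; rewrite !mxE; ring.
rewrite dotZr.
have -> : \sum_k L k * (t *: usubmx d) k 0 ^+ 2 = t ^+ 2 * \sum_k L k * usubmx d k 0 ^+ 2.
  by rewrite mulr_sumr; apply: eq_bigr => k _; rewrite mxE exprMn mulrCA.
have -> : \sum_(j | adj G i j)
    (enorm (c1 j) ^+ 2 + t * (2 * dot (c1 j) (Smx G i j *m d))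
       + t ^+ 2 * dot (Smx G i j *m d) (Smx G i j *m d)
     + (enorm (c2 j) ^+ 2 + t * (2 * dot (c2 j) (Rmx G i j *m d))
       + t ^+ 2 * dot (Rmx G i j *m d) (Rmx G i j *m d)))
  = \sum_(j | adj G i j) (enorm (c1 j) ^+ 2 + enorm (c2 j) ^+ 2)
    + t * 2 * (\sum_(j | adj G i j) (dot (c1 j) (Smx G i j *m d) + dot (c2 j) (Rmx G i j *m d)))
    + t ^+ 2 * (\sum_(j | adj G i j) (dot (Smx G i j *m d) (Smx G i j *m d)
                            + dot (Rmx G i j *m d) (Rmx G i j *m d))).
  by rewrite !mulr_sumr -!big_split; apply: eq_bigr => j _ /=; ring.
lra.
Qed.

End Stationarity.

(** * Energy descent along the iterates and convergence *)

Theorem theorem2 (R : realType) (G : microgrid R) (rho : R)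
  (xopt : forall i : 'I_(nbus G), 'cV[R]_(nvar G i))
  (u : forall i : 'I_(nbus G), nat -> 'cV[R]_(ndim G i))
  (v lam : forall i : 'I_(nbus G), nat -> 'cV[R]_(ncon G i + horizon G))
  (v1 v2 lam1 lam2 : forall i j : 'I_(nbus G), nat -> 'cV[R]_(horizon G))
  (hgraph : connected_graph G)
  (hdata : well_posed_data G)
  (hcosts : good_costs G)
  (hslater : strictly_feasible G)
  (hxopt : MF_optimal G xopt)
  (hrho : 0 < rho)
  (hv : forall i s,
     v i s.+1 = pospart (Mmx G i *m u i s - mvec G i - rho^-1 *: lam i s))
  (hv1 : forall i j, adj G i j -> forall s,
     v1 i j s.+1 = 2^-1 *:
       (Smx G i j *m u i s - rho^-1 *: lam1 i j s
        + Rmx G j i *m u j s - rho^-1 *: lam2 j i s))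
  (hv2 : forall i j, adj G i j -> forall s,
     v2 i j s.+1 = 2^-1 *:
       (Smx G j i *m u j s - rho^-1 *: lam1 j i s
        + Rmx G i j *m u i s - rho^-1 *: lam2 i j s))
  (hu : forall i s,
     is_argmin
       (fun w : 'cV[R]_(ndim G i) =>
          Phihat G i w
          + rho / 2 *
              enorm (Mmx G i *m w - v i s.+1 - mvec G i - rho^-1 *: lam i s) ^+ 2
          + rho / 2 *
              \sum_(j | adj G i j)
                (enorm (Smx G i j *m w - v1 i j s.+1 - rho^-1 *: lam1 i j s) ^+ 2
                 + enorm (Rmx G i j *m w - v2 i j s.+1 - rho^-1 *: lam2 i j s) ^+ 2))
       (u i s.+1))
  (hlam : forall i s,
     lam i s.+1 = lam i s - rho *: (Mmx G i *m u i s.+1 - mvec G i - v i s.+1))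
  (hlam1 : forall i j, adj G i j -> forall s,
     lam1 i j s.+1 = lam1 i j s - rho *: (Smx G i j *m u i s.+1 - v1 i j s.+1))
  (hlam2 : forall i j, adj G i j -> forall s,
     lam2 i j s.+1 = lam2 i j s - rho *: (Rmx G i j *m u i s.+1 - v2 i j s.+1)) :
  forall i : 'I_(nbus G), (fun s : nat => Pmx G i *m u i s) @ \oo --> xopt i.
Proof.
move=> i.
have [_ irr sym _] := hgraph.
have [mu [mu_pos mu_grad]] := optimal_multipliers irr hcosts hxopt.
have grad_opt := consensus_multipliers sym mu_grad.
set us := consistent xopt in mu_pos.
pose beta i := dsubmx (mu i).
(* The consensus terms are grouped by the shared variable [v1 i j], which couples [S_ij u_i] with
   [R_ji u_j]. Both have the same optimal value, with optimal multipliers [- beta i] and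
   [beta i]. *)
pose V s := \sum_i energy rho (Mmx G i *m u i s) (Mmx G i *m us i) (lam i s) (mu i)
  + \sum_i \sum_(j | adj G i j)
     (energy rho (Smx G i j *m u i s) (Smx G i j *m us i) (lam1 i j s) (- beta i)
      + energy rho (Rmx G j i *m u j s) (Smx G i j *m us i) (lam2 j i s) (- - beta i)).
have V0 s : 0 <= V s.
  apply: addr_ge0; apply: sumr_ge0 => k _; first exact: energy_ge0.
  by apply: sumr_ge0 => j _; apply: addr_ge0; exact: energy_ge0.
have [m m0 mP] := gradPhi_strongly_monotone hcosts.
have step s : \sum_k \sum_r m k r * (usubmx (u k s.+1) - xopt k) r 0 ^+ 2 <= V s - V s.+1.
  pose e k := u k s.+1 - us k.
  have eE k : usubmx (e k) = usubmx (u k s.+1) - xopt k.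
    by rewrite /e linearB /= usubmx_consistent.
  (* Strong monotonicity bounds [D] from below by the squared errors; stationarity and the energy
     descent bound [2 * D] from above by the energy drop. *)
  pose D := \sum_k dot (gradPhi (usubmx (u k s.+1)) - gradPhi (xopt k)) (usubmx (e k)).
  have D_ge : \sum_k \sum_r m k r * (usubmx (u k s.+1) - xopt k) r 0 ^+ 2 <= D.
    by apply: ler_sum => k _; rewrite eE; exact: mP.
  apply: (le_trans D_ge).
  have D0 : 0 <= D.
    apply: le_trans D_ge; apply: sumr_ge0 => k _; apply: sumr_ge0 => r _.
    by rewrite mulr_ge0 ?sqr_ge0 // ltW.
  have DE : D = \sum_k dot (lam k s.+1 - mu k) (Mmx G k *m u k s.+1 - Mmx G k *m us k)
    + \sum_k \sum_(j | adj G k j)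
       (dot (lam1 k j s.+1 - - beta k) (Smx G k j *m u k s.+1 - Smx G k j *m us k)
        + dot (lam2 j k s.+1 + - beta k) (Rmx G j k *m u j s.+1 - Smx G k j *m us k)).
    have grad_u : \sum_k dot (gradPhi (usubmx (u k s.+1))) (usubmx (e k))
      = \sum_k dot (lam k s.+1) (Mmx G k *m e k)
        + \sum_k \sum_(j | adj G k j) (dot (lam1 k j s.+1) (Smx G k j *m e k)
            + dot (lam2 j k s.+1) (Rmx G j k *m e j)).
      (* Stationarity of agent [k] yields the terms [lam2 k j]; the swap regroups them as
         [lam2 j k], as in [V]. *)
      rewrite -(sum_adj_swapD (fun k j => dot (lam1 k j s.+1) (Smx G k j *m e k))
        (fun k j => dot (lam2 k j s.+1) (Rmx G k j *m e k)) sym).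
      rewrite -big_split; apply: eq_bigr => k _ /=.
      rewrite (argmin_stationary hrho hcosts (hu k s)) hlam; congr (_ + _).
      by apply: eq_bigr => j kj; rewrite hlam1 // hlam2.
    have RS k j : adj G k j -> Rmx G j k *m us j = Smx G k j *m us k.
      move=> kj; rewrite Rmx_mul Smx_mul copy_of_consistent //.
      by rewrite usubmx_consistent.
    rewrite /D; under eq_bigr do rewrite dotBl.
    rewrite sumrB grad_u (grad_opt e) opprD addrACA -!sumrB; congr (_ + _).
      by apply: eq_bigr => k _; rewrite -dotBl -mulmxBr.
    apply: eq_bigr => k _; rewrite -sumrB; apply: eq_bigr => j kj.
    rewrite -{2}RS // -!mulmxBr -/(e k) -/(e j) -/(beta k) !dotBl !dotNl; ring.
  have : 2 * D <= V s - V s.+1.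
    rewrite DE mulrDr /V opprD addrACA -!sumrB !mulr_sumr; apply: lerD.
      by apply: ler_sum => k _; apply: energy_descent_nonneg (hv k s) (hlam k s) (mu_pos k).
    apply: ler_sum => k _; rewrite mulr_sumr -sumrB; apply: ler_sum => j kj.
    apply: energy_descent_consensus (hv1 k j kj s) (hlam1 k j kj s) _ => //.
    have jk : adj G j k by rewrite sym.
    (* The updates of [v2 j k] and [v1 k j] coincide, so both ends of the line share one consensus
       variable. *)
    by rewrite (hlam2 j k jk s) hv2 // hv1.
  lra.
apply: cvg_mx_entry => r c; rewrite (ord1 c).
apply: (cvg_of_telescoping_bound (m0 i r) V0) => s.
(* Of the sum of weighted squared errors only coordinate [r] of agent [i] is kept; the other terms
   are nonnegative. *)
apply: le_trans (step s); rewrite (bigD1 i) //= (bigD1 r) //=.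
have -> : Pmx G i *m u i s.+1 = usubmx (u i s.+1).
  by rewrite -{1}(vsubmxK (u i s.+1)) mul_row_col mul1mx mul0mx addr0.
rewrite !mxE -addrA lerDl; apply: addr_ge0.
  by apply: sumr_ge0 => k _; rewrite mulr_ge0 ?sqr_ge0 // ltW.
by apply: sumr_ge0 => k _; apply: sumr_ge0 => q _; rewrite mulr_ge0 ?sqr_ge0 // ltW.
Qed.
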